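(* If there exists an optimal allocation $x^\star$ satisfying $\mathsf{OptiVal}(x^\star)=\mathsf{PessVal}(x^\star)=v_1^\star$, then an optimal interior-point allocation must exist.
   Context: Setting. The follower faces a Markov decision process with finite state space $\mathcal S$, finite action space $\mathcal A$, transition kernel $\mathcal T:\mathcal S\times\mathcal A\times\mathcal S\to[0,1]$ ($\mathcal T(s,a,s')$ is the probability of moving from $s$ to $s'$ under action $a$), reward function $r:\mathcal S\times\mathcal A\to\mathbb R$, discount factor $\gamma\in(0,1]$, and initial distribution $\rho$ on $\mathcal S$. A policy is $\pi:\mathcal S\times\mathcal A\to[0,1]$ such that $\pi(s,\cdot)$ is a probability distribution on $\mathcal A$ for every $s$. The occupancy measure induced by $\pi$ is $m(s,a)=\mathbb E_{\pi,s_0\sim\rho}\big[\sum_{t=0}^\infty\gamma^t\,\mathbb P(s_t=s,a_t=a)\big]$. The set of valid occupancy measures is $\mathcal M=\{m\in\mathbb R^{\mathcal S\times\mathcal A}: m\ge0,\ \sum_{a}m(s,a)=\rho(s)+\gamma\sum_{s',a'}\mathcal T(s',a',s)m(s',a')\ \forall s\in\mathcal S\}$. For $f\in\mathbb R^{\mathcal S\times\mathcal A}$, $\langle f,m\rangle=\sum_{(s,a)\in\mathcal S\times\mathcal A}f(s,a)m(s,a)$. $\mathcal S_d=\{s_1,\dots,s_K\}\subseteq\mathcal S$ is the set of states at which the leader can allocate reward. A reward allocation is a function $x:\mathcal S_d\to\mathbb R$, identified with the vector in $\mathbb R^{|\mathcal S_d|}$ with entries $x_i=x(s_i)$. For a given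 budget $C$, the set of admissible allocations is $\mathcal X=\{x: x\ge0,\ \sum_{i=1}^{|\mathcal S_d|}x_i\le C\}$. The follower's modified reward is $r_2^x(s,a)=r(s,a)+x(s)$ for $s\in\mathcal S_d$ and $r_2^x(s,a)=r(s,a)$ for $s\notin\mathcal S_d$. The leader's reward is $r_1(s,a)=1$ if $s\in\mathcal S_d$ and $r_1(s,a)=0$ otherwise. The set of best responses of the follower is $\mathsf{BR}(x)=\arg\max_{m\in\mathcal M}\langle r_2^x,m\rangle$. The reward design problem is: maximize $\langle r_1,m\rangle$ over $x\in\mathcal X$, $m\in\mathcal M$ subject to $m\in\mathsf{BR}(x)$. Its optimal value is $v_1^\star$; if $(x^\star,m^\star)$ is an optimal solution, $x^\star$ is called an optimal allocation and $m^\star$ an optimal occupancy measure. For an allocation $x$, $\mathsf{OptiVal}(x)$ is the optimal value of maximizing $\langle r_1,m\rangle$ over $m\in\mathcal M$ subject to $m\in\mathsf{BR}(x)$, and $\mathsf{PessVal}(x)$ is the optimal value of minimizing $\langle r_1,m\rangle$ over $m\in\mathcal M$ subject to $m\in\mathsf{BR}(x)$. The allocation region of $m\in\mathcal M$ is $\mathcal P_m=\{x\in\mathbb R^{|\mathcal S_d|}: m\in\mathsf{BR}(x)\}$; the allocation region of an optimal occupancy measure is called an optimal allocation region. An allocation $x\in\mathcal X$ is an interior-point allocation of $\mathcal P_m$ if there exists $c>0$ such that $x+cv\in\mathcal P_m$ for all $v\in\mathbb R^{|\mathcal S_d|}$ with $\|v\|_1\le1$. An optimal interior-point allocation is an interior-point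 allocation of an optimal allocation region.
   Formalization: The budget C is assumed positive; for C = 0 the only admissible allocation is 0 and the claim can fail (e.g. two actions leading to two absorbing states of S_d, with zero reward r and discount below 1). *)

(* Defs.v *)
From HB Require Import structures.
From mathcomp Require Import all_boot all_order all_algebra.
From mathcomp Require Import all_classical all_reals ereal.

Set Implicit Arguments.
Unset Strict Implicit.
Unset Printing Implicit Defensive.

Import Order.TTheory GRing.Theory Num.Theory.

Local Open Scope classical_set_scope.
Local Open Scope ring_scope.

(* [mdp_trans M s a s'] is the probability of moving from [s] to [s'] under
   action [a]. *)
Record mdp (R : realType) (S A : finType) := Mdp {
  mdp_trans : S -> A -> S -> R;
  mdp_reward : S * A -> R;
  mdp_discount : R;
  mdp_init : S -> R;
  mdp_trans_ge0 : forall s a s', 0 <= mdp_trans s a s';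
  mdp_trans_sum1 : forall s a, \sum_s' mdp_trans s a s' = 1;
  mdp_discount_gt0 : 0 < mdp_discount;
  mdp_discount_le1 : mdp_discount <= 1;
  mdp_init_ge0 : forall s, 0 <= mdp_init s;
  mdp_init_sum1 : \sum_s mdp_init s = 1
}.

Section RewardDesign.
Variables (R : realType) (S A : finType).

Definition inner (f : S * A -> R) (m : {ffun S * A -> R}) : R :=
  \sum_sa f sa * m sa.

Definition occupancy (M : mdp R S A) : set {ffun S * A -> R} :=
  [set m : {ffun S * A -> R} |
    (forall sa, 0 <= m sa) /\
    forall s, \sum_a m (s, a) =
      mdp_init M s +
      mdp_discount M *
        \sum_(sa : S * A) mdp_trans M sa.1 sa.2 s * m sa].

Variables (M : mdp R S A) (Sd : {set S}) (C : R).

Definition alloc := {ffun {s : S | s \in Sd} -> R}.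

Definition admissible : set alloc :=
  [set x : alloc | (forall i, 0 <= x i) /\ \sum_i x i <= C].

(* [insub s] is [Some i] with [val i = s] exactly when [s \in Sd]. *)
Definition follower_reward (x : alloc) (sa : S * A) : R :=
  mdp_reward M sa + (if insub sa.1 is Some i then x i else 0).

Definition leader_reward (sa : S * A) : R := (sa.1 \in Sd)%:R.

Definition best_response (x : alloc) : set {ffun S * A -> R} :=
  [set m : {ffun S * A -> R} |
    occupancy M m /\
    forall m', occupancy M m' ->
      inner (follower_reward x) m' <= inner (follower_reward x) m].

Definition feasible : set (alloc * {ffun S * A -> R}) :=
  [set xm : alloc * {ffun S * A -> R} |
    admissible xm.1 /\ best_response xm.1 xm.2].

Definition optimal_solution (x : alloc) (m : {ffun S * A -> R}) : Prop :=
  feasible (x, m) /\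
  forall xm, feasible xm -> inner leader_reward xm.2 <= inner leader_reward m.

Definition optimal_allocation (x : alloc) : Prop :=
  exists m, optimal_solution x m.

Definition optimal_occupancy (m : {ffun S * A -> R}) : Prop :=
  exists x, optimal_solution x m.

(* Optimal values are extended reals, so that they are meaningful without
   assuming that the feasible sets are nonempty or the objective bounded. *)
Definition opt_value : \bar R :=
  ereal_sup [set (inner leader_reward xm.2)%:E | xm in feasible].

Definition opti_val (x : alloc) : \bar R :=
  ereal_sup [set (inner leader_reward m)%:E | m in best_response x].

Definition pess_val (x : alloc) : \bar R :=
  ereal_inf [set (inner leader_reward m)%:E | m in best_response x].

Definition allocation_region (m : {ffun S * A -> R}) : set alloc :=
  [set x : alloc | best_response x m].

Definition norm1 (v : alloc) : R := \sum_i `|v i|.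

Definition interior_point (m : {ffun S * A -> R}) (x : alloc) : Prop :=
  admissible x /\
  exists2 c : R, 0 < c &
    forall v : alloc, norm1 v <= 1 ->
      allocation_region m [ffun i => x i + c * v i].

Definition optimal_interior_point (x : alloc) : Prop :=
  exists2 m, optimal_occupancy m & interior_point m x.

End RewardDesign.

(* Main.v *)
Require Import Defs.
From HB Require Import structures.
From mathcomp Require Import all_boot all_order all_algebra.
From mathcomp Require Import all_classical all_reals ereal.
From mathcomp Require Import topology normedtype.
From mathcomp Require Import ring lra.

(* If an occupancy measure beats a fixed representative of its support, moving
   away from the representative until a coordinate vanishes strictly shrinks
   the support without losing value. So finitely many representatives suffice to
   maximize any linear reward, and the follower's optimal value is the maximum
   of finitely many affine functions of the allocation.

   Along the curve (1 - t) x* + (c t^2, c t^3, ...), which stays admissible,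
   the difference of two distinct affine functions is a nonzero polynomial in
   t, hence does not vanish for small t > 0. At such a point a maximizer beats
   every other representative strictly or has the same affine function, so
   it is a best response on a whole ball. For small t it is also a best
   response at x*, so by PessVal(x* ) = v* it is optimal. *)

Set Implicit Arguments.
Unset Strict Implicit.
Unset Printing Implicit Defensive.

Import Order.TTheory GRing.Theory Num.Theory.

Local Open Scope classical_set_scope.
Local Open Scope ring_scope.

(** * Signs of real polynomials just to the right of zero *)

Section PolynomialsNearZero.
Variable R : realType.
Implicit Types p : {poly R}.

(** Factoring gives [p(t) = p(0) + t q(t)] with [q] bounded on [0,1], so the constant term dominates
    for small [t]. *)
Lemma near_horner_gt0 p : 0 < p.[0] -> \forall t \near 0^'+, 0 < p.[t].
Proof.
move=> p0; have /factor_theorem[q qE] : root (p - p.[0]%:P) 0.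
  by rewrite /root !hornerE subrr.
have [B qB] := poly_itv_bound q 0 1.
have B1 : 0 < `|B| + 1 by rewrite ltr_wpDl.
near=> t.
have t0 : 0 < t by near: t; exact: nbhs_right_gt.
have t1 : t < 1 by near: t; exact: nbhs_right_lt.
have tp : t < p.[0] / (`|B| + 1).
  by near: t; apply: nbhs_right_lt; rewrite divr_gt0.
have -> : p.[t] = p.[0] + q.[t] * t.
  by have := congr1 (horner^~ t) qE; rewrite !hornerE; lra.
move: tp; rewrite ltr_pdivlMr // => tp.
have : `|q.[t]| <= B by apply: qB; rewrite (ltW t0) (ltW t1).
rewrite ler_norml => /andP[qN _]; have := ler_norm B; nra.
Unshelve. all: by end_near. Qed.

(** Dividing out the root at 0 with its multiplicity leaves a factor of constant sign near 0. *)
Lemma near_horner_neq0 p : p != 0 -> \forall t \near 0^'+, p.[t] != 0.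
Proof.
move=> p0; have [k [q]] := multiplicity_XsubC p 0.
rewrite p0 /= /root => q0 ->.
have qt : \forall t \near 0^'+, q.[t] != 0.
  case/orP: (lt_total q0) => [q0'|q0'].
    have /near_horner_gt0 : 0 < (- q).[0] by rewrite hornerN oppr_gt0.
    by apply: filterS => t; rewrite hornerN oppr_gt0 lt_neqAle => /andP[].
  by apply: filterS (near_horner_gt0 q0') => t; rewrite lt_neqAle eq_sym => /andP[].
near=> t; rewrite !hornerE mulf_neq0 //; first by near: t.
by rewrite expf_neq0 // subr0 gt_eqF.
Unshelve. all: by end_near. Qed.

Lemma exists_generic_near0 (J : finType) (p : J -> {poly R}) :
  exists t : R, [/\ 0 < t, t < 1 & forall j,
    (0 < (p j).[0] -> 0 < (p j).[t]) /\ (p j != 0 -> (p j).[t] != 0)].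
Proof.
have pos : \forall t \near 0^'+, forall j, 0 < (p j).[0] -> 0 < (p j).[t].
  apply: filter_forall => j.
  have [/near_horner_gt0|_] := boolP (0 < (p j).[0]); first exact: filterS.
  exact: nearW.
have neq : \forall t \near 0^'+, forall j, p j != 0 -> (p j).[t] != 0.
  apply: filter_forall => j.
  have [_|/near_horner_neq0] := eqVneq (p j) 0; first exact: nearW.
  exact: filterS.
near (0 : R)^'+ => t; exists t; split=> [||j].
- by near: t; exact: nbhs_right_gt.
- by near: t; exact: nbhs_right_lt.
- by split; [apply: (near pos t)|apply: (near neq t)].
Unshelve. all: by end_near. Qed.

(** Supplies the radius of the ball: [g] is the margin by which the maximizer wins, [b] bounds how
    fast a unit move of the allocation can close it. *)
Lemma exists_small_scale (J : finType) (g b : J -> R) :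
  exists2 e, 0 < e & forall j, 0 < g j -> e * b j <= g j.
Proof.
have small : \forall e \near 0^'+, forall j, 0 < g j -> e * b j <= g j.
  apply: filter_forall => j.
  have [g0|_] := ltP 0 (g j); last exact: nearW.
  have b1 : 0 < `|b j| + 1 by rewrite ltr_wpDl.
  near=> e => _.
  have e0 : 0 < e by near: e; exact: nbhs_right_gt.
  have : e < g j / (`|b j| + 1).
    by near: e; apply: nbhs_right_lt; rewrite divr_gt0.
  rewrite ltr_pdivlMr //; have := ler_norm (b j); nra.
near (0 : R)^'+ => e; exists e; first by near: e; exact: nbhs_right_gt.
exact: (near small e).
Unshelve. all: by end_near. Qed.

End PolynomialsNearZero.

(** * Reduction to one point per support *)

Section SupportRepresentatives.
Variables (R : realType) (T : finType).
Implicit Types (m d : {ffun T -> R}) (f : T -> R) (Q : set {ffun T -> R}).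

Definition supp m : {set T} := [set i | m i != 0].

Definition move m d (t : R) : {ffun T -> R} := [ffun i => m i + t * d i].

(* [E] plays the role of the affine hull constraints; constant total mass makes
   the set bounded. *)
Definition mass_polytope Q :=
  exists E : set {ffun T -> R},
    [/\ forall m, Q m <-> (forall i, 0 <= m i) /\ E m,
        forall m m' t, E m -> E m' -> E (move m (m - m') t)
      & forall m m', Q m -> Q m' -> \sum_i m i = \sum_i m' i].

(** Equal mass forces the nonzero vector [m - m'] to have a negative coordinate, so the ray from [m]
    leaves the orthant. *)
Lemma mass_polytope_exit Q m m' : mass_polytope Q -> Q m -> Q m' ->
  m != m' -> supp m = supp m' ->
  exists t, [/\ 0 <= t, Q (move m (m - m') t)
              & supp (move m (m - m') t) \proper supp m].
Proof.
move=> [E [QE Eaff mass]] Qm Qm' mm' smm'.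
have [m0 Em] := (QE m).1 Qm; have [m0' Em'] := (QE m').1 Qm'.
set d := m - m'.
have [i0 di0] : exists i, d i < 0.
  apply: contrapT => /forallNP d0.
  have {}d0 i : 0 <= d i by rewrite leNgt; apply/negP.
  have : \sum_i d i = 0.
    under eq_bigr do rewrite !ffunE.
    by rewrite sumrB (mass _ _ Qm Qm') subrr.
  move=> /eqP; rewrite psumr_eq0 => [/allP d00|i _]; last exact: d0.
  case/eqP: mm'; apply/ffunP => i; apply/eqP; rewrite -subr_eq0.
  by have := d00 i (mem_index_enum _); rewrite !ffunE.
(* Ratio test: [F i] is the time at which a decreasing coordinate reaches zero, and the least such
   time is the exit time. *)
pose F i := m i / - d i.
case: (@arg_minP _ _ _ i0 (fun i => d i < 0) F di0) => j dj minj.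
have Fj : 0 <= F j by rewrite divr_ge0 // oppr_ge0 ltW.
exists (F j); split => //.
  apply/QE; split; last exact: Eaff.
  move=> i; rewrite ffunE; have [di|di] := ltP (d i) 0.
    have := minj _ di; rewrite {2}/F ler_pdivlMr ?oppr_gt0 //; lra.
  by rewrite addr_ge0 // mulr_ge0.
apply/properP; split.
  apply/fintype.subsetP => i; rewrite !inE; apply: contraNN => /eqP mi.
  have : i \notin supp m' by rewrite -smm' inE negbK mi.
  by rewrite inE negbK => /eqP mi'; rewrite !ffunE mi mi' subrr mulr0 addr0.
exists j; rewrite !inE.
  apply/eqP => mj; have : j \notin supp m' by rewrite -smm' inE negbK mj.
  rewrite inE negbK => /eqP mj'.
  by move: dj; rewrite !ffunE mj mj' subrr ltxx.
by rewrite negbK ffunE /F -/d; apply/eqP; field; rewrite lt_eqF.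
Qed.

Lemma mass_polytope_reps Q m0 : mass_polytope Q -> Q m0 ->
  exists V : {set T} -> {ffun T -> R},
    (forall I, Q (V I)) /\
    forall f m, Q m -> exists I, \sum_i f i * m i <= \sum_i f i * V I i.
Proof.
move=> pQ Qm0.
pose P I := [set m | Q m /\ supp m = I].
(* Supports that do not occur in [Q] get the default point [m0]. *)
exists (fun I => xget m0 (P I)); split => [I|f m Qm].
  by case: xgetP => [m _ [//]|//].
have [n] := ubnP #|supp m|; elim: n => // n IH in m Qm *; rewrite ltnS => mn.
have [Qm' sm'] : P (supp m) (xget m0 (P (supp m))).
  by apply: xgetPex; exists m.
set m' := xget _ _ in Qm' sm'.
have [le|lt] := leP (\sum_i f i * m i) (\sum_i f i * m' i).
  by exists (supp m).
have mm' : m != m' by apply: contraTneq lt => <-; rewrite ltxx.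
have [t [t0 Qt st]] := mass_polytope_exit pQ Qm Qm' mm' (esym sm').
have [|I leI] := IH _ Qt; first exact: leq_trans (proper_card st) mn.
exists I; apply: le_trans leI.
have -> : \sum_i f i * move m (m - m') t i =
    \sum_i f i * m i + t * (\sum_i f i * m i - \sum_i f i * m' i).
  rewrite -sumrB mulr_sumr -big_split; apply: eq_bigr => i _ /=.
  by rewrite !ffunE; ring.
by rewrite lerDl mulr_ge0 // subr_ge0 ltW.
Qed.

End SupportRepresentatives.

(** * Affine functions along a curve of allocations *)

Section Affine.
Variables (R : realType) (I : finType).
Implicit Types (x b : {ffun I -> R}) (c t : R).

Definition dot b x : R := \sum_i b i * x i.

Lemma dotBl b b' x : dot (b - b') x = dot b x - dot b' x.
Proof. by rewrite -sumrB; apply: eq_bigr => i _; rewrite !ffunE mulrBl. Qed.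

Definition curve x c t : {ffun I -> R} :=
  [ffun i => (1 - t) * x i + c * t ^+ (enum_rank i).+2].

(* The exponents start at 2 because the segment term already contributes in
   degrees 0 and 1. *)
Definition curve_poly x c a b : {poly R} :=
  (a + dot b x)%:P - (dot b x)%:P * 'X
  + \sum_i (b i * c)%:P * 'X^((enum_rank i).+2).

Lemma curve_polyE x c a b t :
  (curve_poly x c a b).[t] = a + dot b (curve x c t).
Proof.
have -> : dot b (curve x c t) =
    (1 - t) * dot b x + \sum_i b i * c * t ^+ (enum_rank i).+2.
  rewrite /dot mulr_sumr -big_split; apply: eq_bigr => i _ /=.
  by rewrite ffunE; ring.
rewrite !(hornerD, hornerN, hornerM, hornerC, hornerX) horner_sum.
under [in LHS]eq_bigr do rewrite hornerM hornerC hornerXn.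
rewrite [RHS]addrA; ring.
Qed.

(** Distinct exponents let each [b i] be read off from its own coefficient; the constant coefficient
    then gives [a]. *)
Lemma curve_poly_eq0 x c a b :
  0 < c -> curve_poly x c a b = 0 -> a = 0 /\ b = 0.
Proof.
move=> c0 p0.
have b0 : b = 0.
  apply/ffunP => i; rewrite ffunE.
  have := congr1 (fun p : {poly R} => p`_(enum_rank i).+2) p0.
  rewrite !coefD coefN coefMX !coefC /= coef_sum (bigD1 i) //=.
  rewrite coefCM coefXn eqxx mulr1 big1 => [|j ji].
    rewrite subr0 add0r addr0 => /eqP.
    by rewrite mulf_eq0 (gt_eqF c0) orbF => /eqP.
  rewrite coefCM coefXn !eqSS.
  by rewrite (inj_eq val_inj) (inj_eq enum_rank_inj) eq_sym (negPf ji) mulr0.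
have dot0 : dot 0 x = 0 by apply: big1 => i _; rewrite ffunE mul0r.
split => //; move: p0; rewrite /curve_poly b0 dot0 big1 => [|i _].
  rewrite mul0r subr0 !addr0 => /(congr1 (fun p : {poly R} => p`_0)).
  by rewrite !coefC.
by rewrite ffunE !mul0r.
Qed.

(** Each power is at most [t], so the curve stays below a convex combination of [x] and a constant
    allocation of total at most [C]. *)
Lemma curve_admissible x C t : 0 < C -> 0 < t -> t < 1 ->
  (forall i, 0 <= x i) -> \sum_i x i <= C ->
  let y := curve x (C / #|I|.+1%:R) t in (forall i, 0 <= y i) /\ \sum_i y i <= C.
Proof.
move=> C0 t0 t1 x0 xC; set c := C / _ => y.
have c0 : 0 < c by rewrite divr_gt0.
split=> [i|].
  rewrite ffunE addr_ge0 // mulr_ge0 ?exprn_ge0 ?subr_ge0 ?(ltW t0) ?(ltW t1) //.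
  exact: ltW.
have : \sum_i y i <= \sum_i ((1 - t) * x i + t * c).
  apply: ler_sum => i _; rewrite ffunE lerD2l mulrC ler_wpM2r ?(ltW c0) //.
  by rewrite exprS ler_piMr ?(ltW t0) // exprn_ile1 // ltW.
rewrite big_split /= -mulr_sumr sumr_const -mulr_natr => /le_trans; apply.
have : c * #|I|%:R <= C.
  have cn : c * #|I|.+1%:R = C by rewrite /c divfK // pnatr_eq0.
  by rewrite -[leRHS]cn ler_wpM2l ?(ltW c0) // ler_nat.
nra.
Qed.

Lemma dot_le_norm1 b (v : {ffun I -> R}) : \sum_i `|v i| <= 1 -> dot b v <= \sum_i `|b i|.
Proof.
move=> v1; apply: ler_sum => i _; apply: le_trans (ler_norm _) _.
rewrite normrM ler_piMr //; apply: le_trans v1.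
by rewrite (bigD1 i) //= lerDl sumr_ge0.
Qed.

End Affine.

(** * The follower's value as an affine function of the allocation *)

Section FollowerValue.
Variables (R : realType) (S A : finType) (M : mdp R S A) (Sd : {set S}).
Implicit Types (m : {ffun S * A -> R}) (x : alloc R Sd).

(** Gradient of the follower's value in the allocation. *)
Definition visits m : alloc R Sd :=
  [ffun i => \sum_(sa : S * A) (insub sa.1 == Some i)%:R * m sa].

Lemma inner_follower_reward x m :
  inner (follower_reward M x) m = inner (mdp_reward M) m + dot (visits m) x.
Proof.
rewrite /dot; under [X in _ = _ + X]eq_bigr do rewrite ffunE mulr_suml.
rewrite exchange_big -big_split; apply: eq_bigr => sa _ /=.
rewrite mulrDl; congr +%R; case: insubP => [i _ _|_].
  rewrite (bigD1 i) //= eqxx mul1r mulrC big1 ?addr0 // => j ji.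
  by rewrite (inj_eq Some_inj) eq_sym (negPf ji) !mul0r.
by rewrite mul0r big1 // => i _; rewrite !mul0r.
Qed.

(** Summing the flow constraints over all states gives mass = 1 + discount * mass, which determines
    the mass for a discount below 1 and is contradictory for discount 1. *)
Lemma occupancy_mass m m' : occupancy M m -> occupancy M m' ->
  \sum_sa m sa = \sum_sa m' sa.
Proof.
have mass u : occupancy M u ->
    \sum_sa u sa = 1 + mdp_discount M * \sum_sa u sa.
  move=> [_ uE].
  have -> : \sum_sa u sa = \sum_s \sum_a u (s, a).
    by rewrite pair_bigA; apply: eq_bigr; case.
  rewrite [LHS](eq_bigr _ (fun s _ => uE s)) big_split /= mdp_init_sum1.
  rewrite -mulr_sumr exchange_big [in RHS]pair_bigA /=; congr (_ + _ * _).
  apply: eq_bigr => -[s a] _.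
  by rewrite -mulr_suml mdp_trans_sum1 mul1r.
move=> /mass mE /mass mE'.
by have [g1|g1] := eqVneq (mdp_discount M) 1; [rewrite g1 in mE; lra|nra].
Qed.

Lemma occupancy_polytope : mass_polytope (occupancy M).
Proof.
exists [set m | forall s, \sum_a m (s, a) = mdp_init M s +
  mdp_discount M * \sum_(sa : S * A) mdp_trans M sa.1 sa.2 s * m sa].
split=> [//|m m' t Em Em' s|]; last exact: occupancy_mass.
have lin (k : S * A -> R) : \sum_sa k sa * move m (m - m') t sa =
    \sum_sa k sa * m sa + t * (\sum_sa k sa * m sa - \sum_sa k sa * m' sa).
  rewrite -sumrB mulr_sumr -big_split; apply: eq_bigr => sa _ /=.
  by rewrite !ffunE; ring.
have -> : \sum_a move m (m - m') t (s, a) =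
    \sum_a m (s, a) + t * (\sum_a m (s, a) - \sum_a m' (s, a)).
  rewrite -sumrB mulr_sumr -big_split; apply: eq_bigr => a _ /=.
  by rewrite !ffunE; ring.
by rewrite lin (Em s) (Em' s); ring.
Qed.

End FollowerValue.

Theorem theorem15 (R : realType) (S A : finType) (M : mdp R S A)
    (Sd : {set S}) (C : R) (C_gt0 : 0 < C) :
  (exists x : alloc R Sd,
     [/\ optimal_allocation M C x,
         opti_val M x = pess_val M x
       & pess_val M x = opt_value M Sd C]) ->
  exists x : alloc R Sd, optimal_interior_point M C x.
Proof.
move=> [x [[m0 [[[x0 xC] /= [Mm0 _]] _]] _ pessE]].
have [V [MV Vmax]] := mass_polytope_reps (occupancy_polytope M) Mm0.
(* The successor keeps [c] positive even when [Sd] is empty. *)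
pose c := C / #|{: {s : S | s \in Sd}}|.+1%:R.
have c0 : 0 < c by rewrite divr_gt0.
pose r := inner (mdp_reward M); pose h m z := r m + dot (visits Sd m) z.
pose p I J := curve_poly x c (r (V I) - r (V J)) (visits Sd (V I) - visits Sd (V J)).
have pE I J t : (p I J).[t] = h (V I) (curve x c t) - h (V J) (curve x c t).
  by rewrite curve_polyE dotBl /h; ring.
have curve0 : curve x c 0 = x.
  by apply/ffunP => i; rewrite ffunE exprS mul0r mulr0 subr0 mul1r addr0.
have [t [t0 t1 tgood]] := exists_generic_near0 (fun IJ => p IJ.1 IJ.2).
set y := curve x c t in pE.
have [y0 yC] := curve_admissible C_gt0 t0 t1 x0 xC.
case: (@arg_maxP _ _ _ finset.set0 predT (fun I => h (V I) y) isT) => K _ Kmax'.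
have Kmax I : h (V I) y <= h (V K) y by exact: Kmax'.
have BR z : (forall I, h (V I) z <= h (V K) z) -> best_response M z (V K).
  move=> Kz; split=> [|m Mm]; first exact: MV.
  have [I /le_trans] := Vmax (follower_reward M z) m Mm; apply.
  rewrite -[leLHS]/(inner _ (V I)) -[leRHS]/(inner _ (V K)).
  rewrite !inner_follower_reward; exact: Kz.
have BRy : best_response M y (V K) by exact: BR.
(* A representative strictly better at [x], the start of the curve, would remain strictly better at
   [y] by the choice of [t]. *)
have BRx : best_response M x (V K).
  apply: BR => I; rewrite leNgt; apply/negP => lt.
  have [+ _] := tgood (I, K); rewrite !pE curve0 !subr_gt0 => /(_ lt).
  by rewrite ltNge Kmax.
(* Feasibility holds at [y]; optimality comes from [x], where no best response falls below the
   optimal value. *)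
have optK : optimal_solution M C y (V K).
  split=> [//|xm fxm]; rewrite -lee_fin.
  apply: (@le_trans _ _ (opt_value M Sd C)).
    by apply: ereal_sup_ubound; exists xm.
  by rewrite -pessE; apply: ereal_inf_lbound; exists (V K).
exists y; exists (V K); first by exists y.
split=> //.
pose B I := \sum_i `|(visits Sd (V I) - visits Sd (V K)) i|.
have [e e0 egap] := exists_small_scale (fun I => h (V K) y - h (V I) y) B.
exists e => // v v1; apply: BR => I.
have dotE b : dot b [ffun i => y i + e * v i] = dot b y + e * dot b v.
  rewrite /dot mulr_sumr -big_split; apply: eq_bigr => i _ /=.
  by rewrite ffunE; ring.
have := dot_le_norm1 (visits Sd (V I) - visits Sd (V K)) v1; rewrite -/(B I).
rewrite dotBl /h !dotE => Bv.
(* Identical affine functions tie everywhere; otherwise the gap at [y] is strict and [e] keeps the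
   perturbation within it. *)
have [pIK|pIK] := eqVneq (p I K) 0.
  have [/subr0_eq rE /subr0_eq ->] := curve_poly_eq0 c0 pIK.
  by rewrite rE.
have := tgood (I, K) => -[_ /(_ pIK)]; rewrite /= pE subr_eq0 => hne.
have hlt : h (V I) y < h (V K) y by rewrite lt_neqAle hne Kmax.
have := egap I; rewrite subr_gt0 => /(_ hlt); rewrite /h; nra.
Qed.
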